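(* Let $G$ be a finite simple graph with girth at least $7$. Then $[2\chi(G), b(G)] \cap \mathbb{Z} \subseteq S_b(G)$; that is, for every integer $k$ with $2\chi(G)\le k\le b(G)$, $G$ has a b-coloring with exactly $k$ colors.
   Context: All graphs are finite and simple; the girth of a graph is the minimum length of a cycle in it (infinite if the graph has no cycle). A (proper) $k$-coloring of $G$ is a map $\psi: V(G)\to\mathbb{N}$ with $|\psi(V(G))|=k$ and $\psi(u)\neq\psi(v)$ whenever $uv\in E(G)$; the sets $\psi^{-1}(i)$ are the color classes. $\chi(G)$ is the chromatic number. Given a coloring $\psi$, a vertex $u$ is a b-vertex if $u$ has a neighbor in every color class other than $\psi^{-1}(\psi(u))$. A b-coloring is a coloring in which every color class contains at least one b-vertex. The b-spectrum $S_b(G)$ is the set of integers $k$ such that $G$ has a b-coloring with $k$ colors, and $b(G)=\max S_b(G)$ is the b-chromatic number. *)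

(* Defs.v *)
From mathcomp Require Import all_boot.
From mathcomp Require Import boolp.

Set Implicit Arguments.
Unset Strict Implicit.
Unset Printing Implicit Defensive.

(* A finite simple graph is a symmetric irreflexive relation on a finType. *)
Definition simple_graph (T : finType) (e : rel T) : Prop :=
  symmetric e /\ irreflexive e.

(* Vertices are listed without repetition and the last is adjacent to the
   first; [2 < size c] discards the degenerate closed walks u and u - v. *)
Definition graph_cycle (T : finType) (e : rel T) (c : seq T) : bool :=
  ucycleb e c && (2 < size c).

(* [None] stands for infinite girth.  Cycles have no repeated vertex, so it is
   enough to look at lengths up to #|T|. *)
Definition girth (T : finType) (e : rel T) : option nat :=
  ohead [seq n <- iota 0 #|T|.+1 | [exists c : n.-tuple T, graph_cycle e c]].

Definition girth_geq (T : finType) (e : rel T) (m : nat) : bool :=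
  if girth e is Some g then m <= g else true.

Lemma girth_geqP (T : finType) (e : rel T) (m : nat) :
  reflect (forall c, graph_cycle e c -> m <= size c) (girth_geq e m).
Proof.
rewrite /girth_geq /girth; set P := fun n => [exists c : n.-tuple T, _].
have Psize c : graph_cycle e c -> size c \in filter P (iota 0 #|T|.+1).
  move=> cc; rewrite mem_filter mem_iota add0n ltnS; apply/andP; split.
    by apply/existsP; exists (in_tuple c).
  by case/andP: cc => /andP[_ /card_uniqP <-] _; apply: max_card.
have: sorted ltn (filter P (iota 0 #|T|.+1)).
  by apply: sorted_filter (iota_ltn_sorted _ _); apply: ltn_trans.
case def_s: (filter P _) Psize => [|g s] /= Psize srt.
  by left=> c /Psize.
apply: (iffP idP) => [le_mg c /Psize | min_m].
  rewrite inE => /predU1P[-> //|/(allP (order_path_min ltn_trans srt))/ltnW].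
  exact: leq_trans.
have : g \in filter P (iota 0 #|T|.+1) by rewrite def_s mem_head.
by rewrite mem_filter => /andP[/existsP[c /min_m]]; rewrite size_tuple.
Qed.

Definition color_class (T : finType) (psi : T -> nat) (i : nat) : {set T} :=
  [set v | psi v == i].

Definition num_colors (T : finType) (psi : T -> nat) : nat :=
  size (undup (codom psi)).

(* Exactly k colors are used. *)
Definition coloring (T : finType) (e : rel T) (k : nat) (psi : T -> nat) : Prop :=
  num_colors psi = k /\ forall u v, e u v -> psi u != psi v.

(* Only the colors in the image of psi count as color classes. *)
Definition b_vertex (T : finType) (e : rel T) (psi : T -> nat) (u : T) : Prop :=
  forall i, i \in codom psi -> i != psi u ->
  exists2 v, v \in color_class psi i & e u v.

Definition b_coloring (T : finType) (e : rel T) (k : nat) (psi : T -> nat) : Prop :=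
  coloring e k psi /\
  forall i, i \in codom psi ->
  exists2 u, u \in color_class psi i & b_vertex e psi u.

Definition b_spectrum (T : finType) (e : rel T) (k : nat) : Prop :=
  exists psi : T -> nat, b_coloring e k psi.

Lemma num_colors_le (T : finType) (psi : T -> nat) : num_colors psi <= #|T|.
Proof. by rewrite -(size_codom psi) size_undup. Qed.

Lemma ex_coloring (T : finType) (e : rel T) (sge : simple_graph e) :
  exists k, `[< exists psi, coloring e k psi >].
Proof.
exists (num_colors (fun x : T => enum_rank x : nat)); apply/asboolP.
exists (fun x : T => enum_rank x : nat); split=> // u v euv.
apply: contraTneq euv => /val_inj/enum_rank_inj ->.
by rewrite sge.2.
Qed.

Definition chromatic_number (T : finType) (e : rel T) (sge : simple_graph e) :
  nat := ex_minn (ex_coloring sge).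

(* A coloring with the fewest colors is a b-coloring, since otherwise a class
   without b-vertex could be distributed among the others. *)
Lemma chromatic_number_b_spectrum (T : finType) (e : rel T) (sge : simple_graph e) :
  b_spectrum e (chromatic_number sge).
Proof.
rewrite /chromatic_number.
case: ex_minnP => k /asboolP[psi psi_k] min_k; exists psi; split=> // i i_psi.
apply: contrapT => no_b.
have /choice[j jP] u : exists j, psi u = i -> [/\ j \in codom psi, j != i
    & forall v, e u v -> psi v != j].
  have [psi_u|] := eqVneq (psi u) i; last by move=> /eqP; exists 0.
  apply: contrapT => no_j; apply: no_b; exists u; first by rewrite inE psi_u.
  move=> j j_psi j_i; apply: contrapT => no_v; apply: no_j; exists j => _.
  split=> //; first by rewrite -psi_u.
  by move=> v euv; apply/eqP=> psi_v; apply: no_v; exists v; rewrite ?inE ?psi_v.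
pose phi u := if psi u == i then j u else psi u.
have phi_proper u v : e u v -> phi u != phi v.
  move=> euv; have ne := psi_k.2 u v euv; rewrite /phi.
  case: (psi u =P i) => [ui|_]; case: (psi v =P i) => [vi|_] //.
  - by rewrite ui vi eqxx in ne.
  - by rewrite eq_sym; case: (jP u ui) => _ _ ->.
  by case: (jP v vi) => _ _ -> //; rewrite sge.1.
have /min_k: `[< exists psi, coloring e (num_colors phi) psi >].
  by apply/asboolP; exists phi.
rewrite leqNgt => /negP; apply; rewrite -psi_k.1 /num_colors.
apply: (@leq_trans (size (i :: undup (codom phi)))) => //.
apply: uniq_leq_size => [|x] /=; rewrite ?undup_uniq ?andbT mem_undup ?inE.
  apply/codomP=> -[u]; rewrite /phi; case: eqP => [ui|ui] iE; last by case: ui.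
  by case: (jP u ui) => _; rewrite iE eqxx.
rewrite mem_undup => /predU1P[-> //|/codomP[u ->]]; rewrite /phi.
by case: eqP => [ui|_]; [case: (jP u ui) | exact: codom_f].
Qed.

Lemma ex_b_spectrum (T : finType) (e : rel T) (sge : simple_graph e) :
  exists k, `[< b_spectrum e k >].
Proof.
by exists (chromatic_number sge); apply/asboolP/chromatic_number_b_spectrum.
Qed.

Lemma b_spectrum_bounded (T : finType) (e : rel T) (k : nat) :
  `[< b_spectrum e k >] -> k <= #|T|.
Proof. by move=> /asboolP[psi [[<- _] _]]; exact: num_colors_le. Qed.

Definition b_chromatic_number (T : finType) (e : rel T) (sge : simple_graph e) :
  nat := ex_maxn (ex_b_spectrum sge) (@b_spectrum_bounded T e).

(* Main.v *)
Require Import Defs.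
From mathcomp Require Import all_boot boolp zify.

(* Let psi be a b-coloring with k+1 colors, k >= 2 chi, and suppose that there is
   none with k colors.  If a set X of vertices of the same color, none of them a
   b-vertex, is recolored vertex by vertex with missing colors, then it is not
   possible that exactly one color loses all its b-vertices: its class could be
   dissolved, which leaves k colors.  Choose psi and a class m such that the size
   of m plus the number of its b-vertices is minimal, and a b-vertex w in m.  For
   a color j without b-vertex among the neighbors of w, recoloring the neighbors
   of w in j destroys w; counting the colors that depend on such neighbors, and
   excluding cycles of length at most 6, shows that there is no such j.  Hence
   w has a neighboring b-vertex of each other color.  Forget one color d0, and
   keep psi on the remaining vertices within distance 1 of these b-vertices.  By
   the girth hypothesis a vertex outside has at most one neighbor there, so that it
   can choose between the two colors that correspond to its color in an optimal
   coloring. *)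

Set Implicit Arguments.
Unset Strict Implicit.
Unset Printing Implicit Defensive.

(** * Short cycles excluded by girth at least 7 *)

Section ShortCycles.

Variables (T : finType) (e : rel T).
Hypothesis sge : simple_graph e.
Hypothesis girth7 : girth_geq e 7.

Lemma edge_neq u v : e u v -> u != v.
Proof. by apply: contraTneq => ->; rewrite sge.2. Qed.

Lemma no_short_cycle c : cycle e c -> uniq c -> 2 < size c < 7 -> False.
Proof.
move=> cc uc /andP[c3 c7]; move: c7; rewrite ltnNge.
by rewrite (girth_geqP e 7 girth7) // /graph_cycle /ucycleb cc uc.
Qed.

Lemma no_C3 a b c : e a b -> e b c -> e c a -> False.
Proof.
move=> ab bc ca; apply: (@no_short_cycle [:: a; b; c]) => //=.
  by rewrite ab bc ca.
by rewrite !inE !negb_or !edge_neq // sge.1.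
Qed.

Lemma no_C4 a b c d :
  e a b -> e b c -> e c d -> e d a -> a != c -> b != d -> False.
Proof.
move=> ab bc cd da ac bd; apply: (@no_short_cycle [:: a; b; c; d]) => //=.
  by rewrite ab bc cd da.
by rewrite !inE !negb_or ac bd !edge_neq // sge.1.
Qed.

(* Two vertices at distance 2 on a closed walk of length 5 are distinct, since
   the rest of the walk would be a triangle. *)
Lemma no_C5 a b c d f :
  e a b -> e b c -> e c d -> e d f -> e f a -> False.
Proof.
have neq x y z t : e x y -> e y z -> e z t -> t != x.
  by move=> xy yz zt; apply/eqP => tx; rewrite tx in zt; apply: (no_C3 xy yz).
move=> ab bc cd df fa; apply: (@no_short_cycle [:: a; b; c; d; f]) => //=.
  by rewrite ab bc cd df fa.
rewrite !inE !negb_or !(@edge_neq a b, @edge_neq b c, @edge_neq c d, @edge_neq d f) //.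
rewrite [a == f]eq_sym (edge_neq fa) (neq c d f a) // (neq d f a b) // (neq f a b c) //.
by rewrite [a == d]eq_sym [b == f]eq_sym (neq a b c d) // (neq b c d f).
Qed.

(* Opposite vertices of a closed walk of length 6 are always distinct. *)
Lemma no_C6 a b c d f g :
  e a b -> e b c -> e c d -> e d f -> e f g -> e g a ->
  a != c -> b != d -> c != f -> d != g -> f != a -> g != b -> False.
Proof.
have neq x y z t : e x y -> e y z -> e z t -> x != t.
  by move=> xy yz zt; apply/eqP => tx; rewrite -tx in zt; apply: (no_C3 xy yz).
move=> ab bc cd df fg ga ac bd cf dg fa gb.
apply: (@no_short_cycle [:: a; b; c; d; f; g]) => //=.
  by rewrite ab bc cd df fg ga.
rewrite !inE !negb_or ac bd cf dg [a == f]eq_sym fa [b == g]eq_sym gb.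
rewrite (neq a b c d) // (neq b c d f) // (neq c d f g) //.
rewrite (edge_neq ab) (edge_neq bc) (edge_neq cd) (edge_neq df) (edge_neq fg).
by rewrite [a == g]eq_sym (edge_neq ga).
Qed.

End ShortCycles.

(** * b-colorings with a prescribed color set *)

Section BColorings.

Variables (T : finType) (e : rel T) (C : finType).
Implicit Types (psi : {ffun T -> C}) (S : {set C}) (v : T) (c : C).

Definition sees psi v c := [exists u, e v u && (psi u == c)].

Definition proper_col psi := [forall u, forall v, e u v ==> (psi u != psi v)].

Definition bvert S psi v := [forall c in S, (c != psi v) ==> sees psi v c].

(** The last clause makes every color of [S] occur, so [psi] uses exactly the colors of [S]. *)
Definition bcol S psi :=
  [&& proper_col psi, [forall v, psi v \in S] &
      [forall c in S, exists v, (psi v == c) && bvert S psi v]].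

Lemma seesP psi v c : reflect (exists2 u, e v u & psi u = c) (sees psi v c).
Proof.
by apply: (iffP existsP) => [[u /andP[vu /eqP]]|[u vu <-]]; exists u; rewrite ?vu ?eqxx.
Qed.

Lemma proper_colP psi :
  reflect (forall u v, e u v -> psi u != psi v) (proper_col psi).
Proof.
apply: (iffP 'forall_forallP) => H u v; first by apply/implyP.
by apply/implyP/H.
Qed.

Lemma bvertP S psi v :
  reflect (forall c, c \in S -> c != psi v -> exists2 u, e v u & psi u = c)
          (bvert S psi v).
Proof.
apply: (iffP forall_inP) => H c cS; first by move=> cv; apply/seesP/(implyP (H c cS)).
by apply/implyP => cv; apply/seesP/H.
Qed.

Lemma bcol_b_spectrum S psi : bcol S psi -> b_spectrum e #|S|.
Proof.
case/and3P=> /proper_colP pr /forallP psiS /forall_inP bS.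
pose phi v : nat := enum_rank (psi v).
have phiE u v : (phi u == phi v) = (psi u == psi v).
  by rewrite /phi (inj_eq val_inj) (inj_eq enum_rank_inj).
have im : codom phi =i [seq (enum_rank c : nat) | c <- enum S].
  move=> n; apply/codomP/mapP => [[v ->]|[c]].
    by exists (psi v); rewrite ?mem_enum.
  rewrite mem_enum => /bS/existsP[v /andP[/eqP<- _]] ->.
  by exists v.
exists phi; split; [split|].
- rewrite /num_colors cardE -(size_map (fun c => enum_rank c : nat)).
  apply/eqP; rewrite -(@uniq_size_uniq _ _ (undup (codom phi))) ?undup_uniq //.
    by rewrite map_inj_uniq ?enum_uniq // => x y /val_inj/enum_rank_inj.
  by move=> x; rewrite mem_undup im.
- by move=> u v uv; rewrite phiE pr.
move=> n; rewrite im => /mapP[c]; rewrite mem_enum => cS ->.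
have /existsP[v /andP[/eqP vc /bvertP bv]] := bS c cS.
exists v; first by rewrite inE /phi vc.
move=> n'; rewrite im => /mapP[d]; rewrite mem_enum => dS -> nd.
have [|u vu ud] := bv d dS.
  by apply: contra nd => /eqP ->.
by exists u; rewrite ?inE ?/phi ?ud.
Qed.

End BColorings.

Lemma b_spectrum_bcol (T : finType) (e : rel T) (n : nat) :
  b_spectrum e n -> exists psi : {ffun T -> 'I_n}, bcol e setT psi.
Proof.
case=> phi [[nphi pr] bphi]; pose s := undup (codom phi).
have phis v : phi v \in s by rewrite mem_undup codom_f.
have idx v : index (phi v) s < n by rewrite -nphi index_mem.
pose psi := [ffun v => Ordinal (idx v)].
have psiE u v : (psi u == psi v) = (phi u == phi v).
  rewrite !ffunE -val_eqE /=; apply/eqP/eqP => [|-> //].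
  by move=> E; rewrite -(nth_index 0 (phis u)) E nth_index.
have nthE (c : 'I_n) : nth 0 s c \in codom phi.
  by rewrite -mem_undup mem_nth // -/(num_colors phi) nphi.
have psiN v (c : 'I_n) : phi v = nth 0 s c -> psi v = c.
  move=> E; apply/val_inj; rewrite ffunE /= E index_uniq ?undup_uniq //.
  by rewrite -/(num_colors phi) nphi.
exists psi; apply/and3P; split.
- by apply/proper_colP => u v uv; rewrite psiE pr.
- by apply/forallP.
apply/forall_inP => c _.
have [v] := bphi _ (nthE c); rewrite inE => /eqP vc bv.
apply/existsP; exists v; rewrite (psiN _ _ vc) eqxx /=.
apply/bvertP => d _; rewrite (psiN _ _ vc) => dc.
have [|u] := bv (nth 0 s d) (nthE d); last by rewrite inE => /eqP/psiN; exists u.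
by rewrite vc nth_uniq ?undup_uniq // -/(num_colors phi) nphi.
Qed.

(** * Recoloring with missing colors *)

Section Recoloring.

Variables (T : finType) (e : rel T) (C : finType).
Implicit Types (psi : {ffun T -> C}) (X : {set T}) (v : T) (c : C).

(** The default [psi v] occurs only at b-vertices for the full color set. *)
Definition miss psi v := odflt (psi v) [pick c | (c != psi v) && ~~ sees e psi v c].

Definition recolor psi X := [ffun v => if v \in X then miss psi v else psi v].

(* The colors that may lose all their b-vertices when X, a set of vertices of
   color j, is recolored. *)
Definition dependents psi j X :=
  [set i | (i != j) && [forall u, ((psi u == i) && bvert e setT psi u) ==>
     [forall v, (e u v && (psi v == j)) ==> (v \in X)]]].

Lemma missP psi v :
  ~~ bvert e setT psi v -> miss psi v != psi v /\ ~~ sees e psi v (miss psi v).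
Proof.
rewrite /miss; case: pickP => [c /andP[] //|none] /bvertP[] c _ cv.
by have := none c; rewrite cv /= => /negbFE/seesP.
Qed.

Lemma dependentsP psi j X i :
  reflect (i != j /\ forall u, psi u = i -> bvert e setT psi u ->
             forall v, e u v -> psi v = j -> v \in X)
          (i \in dependents psi j X).
Proof.
rewrite inE; apply: (iffP andP) => -[ij H]; split=> //.
  move=> u ui bu v uv vj; move: H => /forallP/(_ u).
  by rewrite ui eqxx bu => /forallP/(_ v); rewrite uv vj eqxx.
apply/forallP => u; apply/implyP => /andP[/eqP ui bu].
by apply/forallP => v; apply/implyP => /andP[uv /eqP vj]; apply: (H u).
Qed.

Section MonochromaticSet.

Hypothesis sym : symmetric e.
Variables (psi : {ffun T -> C}) (j : C) (X : {set T}).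
Hypothesis pr : proper_col e psi.
Hypothesis Xj : {in X, forall v, psi v = j}.
Hypothesis Xnb : {in X, forall v, ~~ bvert e setT psi v}.

(** A set of a single color is independent, so the neighbors of a recolored vertex keep their
    colors, and none has the missing color. *)
Lemma recolor_proper : proper_col e (recolor psi X).
Proof.
have missN u v : u \in X -> e u v -> miss psi u != psi v.
  move=> uX uv; have [_] := missP (Xnb uX); apply: contra => /eqP E.
  by apply/seesP; exists v.
apply/proper_colP => u v uv; have := proper_colP _ _ pr _ _ uv.
rewrite !ffunE; case: ifP => uX; case: ifP => vX ne //.
- by move: ne; rewrite !Xj ?eqxx.
- exact: missN.
- by rewrite eq_sym missN // sym.
Qed.

(** No b-vertex lies in [X], and [j] is the only color that it can stop seeing. A color that is no
    dependent is [j] itself or has a b-vertex with a neighbor of color [j] outside [X]. *)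
Lemma recolor_bvert u :
  bvert e setT psi u -> psi u \notin dependents psi j X ->
  exists2 v, recolor psi X v = psi u & bvert e setT (recolor psi X) v.
Proof.
move=> bu; have uX : u \notin X by apply: contraTN bu; exact: Xnb.
have keep v : v \notin X -> recolor psi X v = psi v.
  by rewrite ffunE => /negbTE->.
suff H w : psi w = psi u -> bvert e setT psi w ->
    (psi u != j -> exists2 v, e w v /\ psi v = j & v \notin X) ->
    exists2 v, recolor psi X v = psi u & bvert e setT (recolor psi X) v.
  rewrite inE negb_and negbK => /orP[/eqP uj|].
    by apply: (H u) => //; rewrite uj eqxx.
  case/forallPn => w; rewrite negb_imply => /andP[/andP[/eqP wu bw]].
  case/forallPn => v; rewrite negb_imply => /andP[/andP[wv /eqP vj] vX].
  by apply: (H w) => // _; exists v.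
move=> wu bw out; have wX : w \notin X by apply: contraTN bw; exact: Xnb.
exists w; first by rewrite keep.
apply/bvertP => c _; rewrite keep // => cw.
have [cj|cj] := eqVneq c j.
  have [|v [wv vj] vX] := out; first by rewrite -wu -cj eq_sym.
  by exists v; rewrite ?keep ?vj.
have [v wv vc] := bvertP _ _ _ _ bw c (in_setT _) cw.
exists v; rewrite ?keep //; apply: contra cj => /Xj <-.
by rewrite vc.
Qed.

End MonochromaticSet.

(** Only vertices of color [i] change, each to a missing color, so the other b-vertices still see
    all remaining colors. *)
Lemma drop_color psi i :
  symmetric e -> proper_col e psi ->
  (forall v, psi v = i -> ~~ bvert e setT psi v) ->
  (forall c, c != i -> exists2 v, psi v = c & bvert e setT psi v) ->
  bcol e [set~ i] (recolor psi [set v | psi v == i]).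
Proof.
move=> sym pr nb bs; set X := [set v | _].
have XE v : (v \in X) = (psi v == i) by rewrite inE.
apply/and3P; split.
- apply: (@recolor_proper sym _ i) => // v; rewrite XE => /eqP //.
  exact: nb.
- apply/forallP => v; rewrite !inE ffunE XE; case: ifP => [/eqP vi|->//].
  by have [] := missP (nb _ vi); rewrite vi.
apply/forall_inP => c; rewrite !inE => ci; have [v vc bv] := bs c ci.
have keep w : psi w != i -> recolor psi X w = psi w.
  by rewrite ffunE XE => /negbTE->.
apply/existsP; exists v; rewrite keep vc ?eqxx //=.
apply/bvertP => d; rewrite !inE keep ?vc // => di dc.
have [|w vw wd] := bvertP _ _ _ _ bv d (in_setT _); first by rewrite vc.
by exists w; rewrite ?keep ?wd.
Qed.

(** Only a dependent color can lose all its b-vertices. If a single one did, [drop_color] would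
    leave [#|C|.-1] colors, against the hypothesis. *)
Lemma recolor_bcol psi j X :
  symmetric e -> ~ b_spectrum e #|C|.-1 -> bcol e setT psi ->
  {in X, forall v, psi v = j} -> {in X, forall v, ~~ bvert e setT psi v} ->
  #|dependents psi j X| <= 1 -> bcol e setT (recolor psi X).
Proof.
move=> sym nok /and3P[pr _ /forall_inP bs] Xj Xnb U1.
have pr' := recolor_proper sym pr Xj Xnb.
have bs' c : c \notin dependents psi j X ->
    exists2 v, recolor psi X v = c & bvert e setT (recolor psi X) v.
  move=> cU; have /existsP[u /andP[/eqP uc bu]] := bs c (in_setT c).
  by have := recolor_bvert Xj Xnb bu; rewrite uc; apply.
have TS : [forall v, recolor psi X v \in [set: C]] by apply/forallP.
rewrite /bcol pr' TS /=; apply/forall_inP => i _; apply: contraT => /existsPn /= lost.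
have lost' v : recolor psi X v = i -> ~~ bvert e setT (recolor psi X) v.
  by move=> vi; have := lost v; rewrite vi eqxx; case: bvert.
case: nok; rewrite -(cardsC1 i); apply: bcol_b_spectrum.
apply: (drop_color sym pr' lost') => c ci; apply: (bs').
apply: contra ci => cU; apply/eqP/(card_le1_eqP U1) => //.
apply: contraT => /bs'[v vi bv]; have := lost v.
by rewrite vi eqxx bv.
Qed.

End Recoloring.

(** Choosing an element of each [F j] gives an injective map of the finite set [J] to itself, hence
    a bijection. So every element of [F j] is a chosen one, and disjointness makes it the one chosen
    for [j]. *)
Lemma disjoint_subsets_singletons (C : finType) (J : {set C}) (F : C -> {set C}) :
  {in J, forall j, F j \subset J} -> {in J, forall j, F j != set0} ->
  {in J &, forall i j c, c \in F i -> c \in F j -> i = j} ->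
  {in J, forall j, #|F j| = 1} /\
  {in J, forall c, exists2 j, j \in J & c \in F j}.
Proof.
move=> FJ F0 Fdis; pose f j := odflt j [pick c in F j].
have fF j : j \in J -> f j \in F j.
  rewrite /f => /F0/set0Pn[c cF]; case: pickP => [//|/(_ c)].
  by rewrite cF.
have fJ : f @: J = J.
  apply/eqP; rewrite eqEcard card_in_imset ?leqnn ?andbT.
    by apply/subsetP => _ /imsetP[j jJ ->]; apply: (subsetP (FJ j jJ)); exact: fF.
  move=> i j iJ jJ fij; apply: (Fdis i j iJ jJ (f i)); rewrite ?fF //.
  by rewrite fij fF.
split=> [j jJ|c]; last by rewrite -{1}fJ => /imsetP[j jJ ->]; exists j => //; apply: fF.
apply/eqP/cards1P; exists (f j); apply/setP => c; rewrite inE.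
apply/idP/eqP => [cF|->]; last exact: fF.
have : c \in f @: J by rewrite fJ (subsetP (FJ j jJ)).
by case/imsetP => i iJ cE; rewrite cE (Fdis i j iJ jJ c) ?cE ?fF // -cE.
Qed.

(** * A vertex with a neighboring b-vertex of every other color *)

Section Hub.

Variables (T : finType) (e : rel T) (C : finType).
Hypothesis sge : simple_graph e.
Hypothesis girth7 : girth_geq e 7.
Hypothesis nok : ~ b_spectrum e #|C|.-1.

Let sym : symmetric e := sge.1.

Definition class_weight (p : {ffun T -> C} * C) :=
  #|[set v | p.1 v == p.2]| + #|[set v | (p.1 v == p.2) && bvert e setT p.1 v]|.

Section MinimalClass.

Variables (psi : {ffun T -> C}) (m : C).
Hypothesis psi_b : bcol e setT psi.
Hypothesis min_psi : forall psi' : {ffun T -> C},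
  bcol e setT psi' -> class_weight (psi, m) <= class_weight (psi', m).

Let pr u v : e u v -> psi u != psi v.
Proof. by case/and3P: psi_b => /proper_colP H _ _; apply: H. Qed.

Let has_b c : exists2 v, psi v = c & bvert e setT psi v.
Proof.
case/and3P: psi_b => _ _ /forall_inP/(_ c (in_setT c))/existsP[v /andP[/eqP vc bv]].
by exists v.
Qed.

(** Otherwise [y] alone could be recolored. It leaves class [m], and no b-vertex arises there
    because no vertex of class [m] is adjacent to [y]; the weight would drop. *)
Lemma nonb_dependents y :
  psi y = m -> ~~ bvert e setT psi y -> 1 < #|dependents e psi m [set y]|.
Proof.
move=> ym nby; rewrite ltnNge; apply/negP => U1.
have : bcol e setT (recolor e psi [set y]).
  by apply: recolor_bcol U1 => // v; rewrite inE => /eqP->.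
move/min_psi; apply/negP; rewrite -ltnNge /class_weight /= -addSn.
have psi'E v : recolor e psi [set y] v == m -> (v != y) && (psi v == m).
  rewrite ffunE inE; case: ifP => [/eqP->|_ -> //].
  by case: (missP nby) => + _; rewrite ym => /negbTE->.
apply: leq_add.
  apply/proper_card/properP; split.
    by apply/subsetP => v; rewrite !inE => /psi'E/andP[].
  exists y; rewrite !inE ?ym ?eqxx //.
  by apply/negP => /psi'E/andP[]; rewrite eqxx.
apply/subset_leq_card/subsetP => v; rewrite !inE => /andP[/[dup] v'm /psi'E/andP[vy vm]].
rewrite vm /= => /bvertP bv; apply/bvertP => c _ cv.
have [|u vu uc] := bv c (in_setT c); first by rewrite (eqP v'm) -(eqP vm).
exists u => //; move: uc; rewrite ffunE inE; case: eqP => [uy|//].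
by have := pr vu; rewrite uy ym vm.
Qed.

Variable w : T.
Hypothesis wm : psi w = m.
Hypothesis bw : bvert e setT psi w.

Let X j := [set v | e w v && (psi v == j)].
(** The far colors; the aim is to show that there are none. *)
Let J := [set j | (j != m) && [forall v in X j, ~~ bvert e setT psi v]].

Let XP v j : reflect (e w v /\ psi v = j) (v \in X j).
Proof. by rewrite inE; apply: (iffP andP) => -[? /eqP]. Qed.

Let Jnb j : j \in J -> {in X j, forall v, ~~ bvert e setT psi v}.
Proof. by rewrite inE => /andP[_ /forall_inP]. Qed.

Let Jm j : j \in J -> j != m.
Proof. by rewrite inE => /andP[]. Qed.

Let notJ c : c != m -> c \notin J -> exists2 s, e w s & psi s = c /\ bvert e setT psi s.
Proof.
rewrite inE => -> /= /forall_inPn[s /XP[ws sc]]; rewrite negbK => bs.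
by exists s.
Qed.

(** Recoloring [X j] adds no vertex to class [m], which [X j] sees at [w], and [w] stops being a
    b-vertex. By minimality another vertex of class [m] becomes one, which requires a neighbor in
    [X j]. *)
Lemma recolor_gain j :
  j \in J -> #|dependents e psi j (X j)| <= 1 ->
  [exists y, [&& psi y == m, ~~ bvert e setT psi y & [exists x in X j, e x y]]].
Proof.
move=> jJ U1; apply: contraT => /existsPn /= none.
have Xj : {in X j, forall v, psi v = j} by move=> v /XP[].
have := min_psi (recolor_bcol sym nok psi_b Xj (Jnb jJ) U1).
rewrite leqNgt => /negP[]; rewrite /class_weight /= -addnS.
have psi'E v : recolor e psi (X j) v == m -> (v \notin X j) && (psi v == m).
  rewrite ffunE; case: ifP => // vX; case: (missP (Jnb jJ vX)) => _ /seesP ns /eqP vm.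
  by case: ns; exists w; rewrite ?vm // sym; case/XP: vX.
apply: leq_add.
  by apply/subset_leq_card/subsetP => v; rewrite !inE => /psi'E/andP[].
apply/proper_card/properP; split.
  apply/subsetP => v; rewrite !inE => /andP[/[dup] v'm /psi'E/andP[vX vm] bv].
  rewrite vm /=; apply: contraT => nbv.
  have := none v; rewrite vm nbv /= => /exists_inPn noX.
  case/bvertP: nbv => c _ cv.
  have [|u vu uc] := bvertP _ _ _ _ bv c (in_setT c).
    by rewrite (eqP v'm) -(eqP vm).
  exists u => //; move: uc; rewrite ffunE; case: ifP => // uX.
  by have := noX u uX; rewrite sym vu.
have wX : w \notin X j by apply/negP => /XP[]; rewrite sge.2.
exists w; rewrite !inE ?wm ?eqxx //; apply/nandP; right.
apply/bvertP => /(_ j (in_setT j)); rewrite ffunE (negbTE wX) wm => /(_ (Jm jJ))[u wu].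
rewrite ffunE; case: ifP => [uX|uX uj].
  by case: (missP (Jnb jJ uX)) => + _; rewrite (Xj u uX) => /eqP.
by move: uX; rewrite inE wu uj eqxx.
Qed.

(** If [c] is not far, it has a b-vertex adjacent to [w], a vertex of color [m] other than [y]. *)
Lemma nonb_dependents_far y c :
  psi y = m -> ~~ bvert e setT psi y -> c \in dependents e psi m [set y] -> c \in J.
Proof.
move=> ym nby /dependentsP[cm dep]; apply: contraT => /(notJ cm)[s ws [sc bs]].
have := dep s sc bs w; rewrite sym inE => /(_ ws wm)/eqP wy.
by rewrite -wy bw in nby.
Qed.

(** A b-vertex of color [c] next to [w] would have a neighbor in [X j], closing a triangle with
    [w]. *)
Lemma hub_dependents_far j c :
  j \in J -> c \in dependents e psi j (X j) -> c != m -> c \in J.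
Proof.
move=> jJ /dependentsP[cj dep] cm; apply: contraT => /(notJ cm)[s ws [sc bs]].
have [|x sx xj] := bvertP _ _ _ _ bs j (in_setT j); first by rewrite sc eq_sym.
have /XP[wx _] := dep s sc bs x sx xj.
by case: (no_C3 sge girth7 ws sx); rewrite sym.
Qed.

Lemma dependents_edge j Y c u :
  c \in dependents e psi j Y -> psi u = c -> bvert e setT psi u ->
  exists x, [/\ e u x, psi x = j & x \in Y].
Proof.
case/dependentsP=> cj dep uc bu.
have [|x ux xj] := bvertP _ _ _ _ bu j (in_setT j); first by rewrite uc eq_sym.
by exists x; rewrite (dep u uc bu x ux xj).
Qed.

(* To each far color j, attach the colors that depend on X j, or, if there are
   too few of them, on the vertex of class m which becomes a b-vertex when X j
   is recolored.  These sets are disjoint by the girth hypothesis, hence they are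
   singletons that cover J, and the second case never occurs. *)
Lemma far_colors_empty : J = set0.
Proof.
pose gainer j y := [&& psi y == m, ~~ bvert e setT psi y & [exists x in X j, e x y]].
pose low j := #|dependents e psi j (X j)| <= 1.
pose y_ j := odflt w [pick y | gainer j y].
have y_P j : j \in J -> low j -> [/\ psi (y_ j) = m, ~~ bvert e setT psi (y_ j) &
    exists x, [/\ e w x, psi x = j & e x (y_ j)]].
  move=> jJ lj; rewrite /y_; case: pickP => [y /and3P[/eqP ym nby]|none].
    by case/exists_inP=> x /XP[wx xj] xy; split=> //; exists x.
  by have /existsP[y yP] := recolor_gain jJ lj; have := none y; rewrite /gainer yP.
have y_w j : j \in J -> low j -> w != y_ j.
  by move=> jJ lj; have [_ + _] := y_P j jJ lj; apply: contraNneq => <-.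
pose F j := if low j then dependents e psi m [set y_ j]
            else dependents e psi j (X j) :\ m.
have F_low j c u : low j -> c \in F j -> psi u = c -> bvert e setT psi u -> e u (y_ j).
  rewrite /F => -> cF uc bu; have [x [ux _]] := dependents_edge cF uc bu.
  by rewrite inE => /eqP<-.
have F_high j c u : ~~ low j -> c \in F j -> psi u = c -> bvert e setT psi u ->
    exists x, [/\ e u x, psi x = j & e w x].
  rewrite /F => /negbTE-> /setD1P[_ cF] uc bu.
  by have [x [ux xj /XP[wx _]]] := dependents_edge cF uc bu; exists x.
have FJ : {in J, forall j, F j \subset J}.
  move=> j jJ; apply/subsetP => c; rewrite /F; case: ifP => lj.
    by have [ym nby _] := y_P j jJ lj; apply: nonb_dependents_far.
  by case/setD1P => cm cF; apply: (hub_dependents_far jJ cF cm).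
have FJm j c : j \in J -> c \in F j -> c != m.
  by move=> jJ cF; apply/Jm/(subsetP (FJ j jJ)).
(* In the second case there are two dependents, so one is left when [m], which is not far, is
   removed. *)
have F0 : {in J, forall j, F j != set0}.
  move=> j jJ; rewrite -card_gt0 /F; case: ifPn => [lj|].
    by have [ym nby _] := y_P j jJ lj; apply/ltnW/nonb_dependents.
  rewrite /low -ltnNge (cardsD1 m) => lj.
  by rewrite -(ltn_add2l 1) (leq_trans lj) // leq_add2r leq_b1.
(* The closed walk [u], [y_ i], [x], [w], [x'] would have length 5. *)
have mixed i j c : i \in J -> low i -> ~~ low j -> c \in F i -> c \in F j -> False.
  move=> iJ li lj ci cj; have [u uc bu] := has_b c.
  have uy := F_low _ _ _ li ci uc bu; have [x' [ux' _ wx']] := F_high _ _ _ lj cj uc bu.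
  have [_ _ [x [wx _ xy]]] := y_P i iJ li.
  by apply: (no_C5 sge girth7 uy (_ : e _ x) (_ : e _ w) wx'); rewrite sym.
have same x x' u i j : e w x -> psi x = i -> e w x' -> psi x' = j ->
    e x u -> e x' u -> w != u -> i = j.
  move=> wx <- wx' <- xu x'u wu; have [-> //|xx'] := eqVneq x x'.
  by case: (no_C4 sge girth7 wx xu (_ : e _ x')); rewrite // sym.
have Fdis : {in J &, forall i j c, c \in F i -> c \in F j -> i = j}.
  move=> i j iJ jJ c ci cj; have [u uc bu] := has_b c.
  have [li|li] := boolP (low i); have [lj|lj] := boolP (low j).
  (* The only neighbor of [u] of color [m] is [y_ i], so [y_ j] equals it, and [same] applies to
     this vertex and [w]. *)
  - have uy := F_low _ _ _ lj cj uc bu; have [yjm _ [x' [wx' x'j x'y]]] := y_P j jJ lj.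
    have [_ _ [x [wx xi xy]]] := y_P i iJ li.
    move: ci; rewrite /F li => /dependentsP[_ /(_ u uc bu _ uy yjm)].
    rewrite inE => /eqP yE; rewrite yE in x'y.
    by apply: (same x x' (y_ i)); rewrite ?y_w.
  - by case: (mixed i j c).
  - by case: (mixed j i c).
  have [x [ux xi wx]] := F_high _ _ _ li ci uc bu.
  have [x' [ux' x'j wx']] := F_high _ _ _ lj cj uc bu.
  apply: (same x x' u); rewrite // 1?sym //.
  by apply: contraTneq (FJm j c jJ cj) => E; rewrite -uc -E wm eqxx.
have [F1 Fcover] := disjoint_subsets_singletons FJ F0 Fdis.
(* A low [j] would make [F j] a set of at least two colors. *)
have high j : j \in J -> ~~ low j.
  move=> jJ; apply/negP => lj; have [ym nby _] := y_P j jJ lj.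
  by have := nonb_dependents ym nby; have := F1 j jJ; rewrite /F lj => ->.
(* [X j] has at least two dependents, but only one other than [m]. *)
have mF j : j \in J -> m \in dependents e psi j (X j).
  move=> jJ; have := F1 j jJ; have := high j jJ; rewrite /F => /[dup] hj /negbTE-> Fj.
  by move: hj; rewrite /low (cardsD1 m) Fj; case: (m \in _).
(* Two colors that depend on [y] are far and covered by the sets [F j]. Their b-vertices are
   adjacent to [y] and joined to [w] by paths of length 2, which gives a cycle of length 4 or 6. *)
have allb y : psi y = m -> bvert e setT psi y.
  move=> ym; apply: contraT => nby.
  have /card_gt1P[c1 [c2 [c1y c2y c12]]] := nonb_dependents ym nby.
  have far c : c \in dependents e psi m [set y] ->
      exists u x, [/\ psi u = c, e y u, e u x, e x w & psi x != m].
    move=> cy; have [u uc bu] := has_b c.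
    have [j jJ cj] := Fcover c (nonb_dependents_far ym nby cy).
    have [x [ux xj wx]] := F_high _ _ _ (high j jJ) cj uc bu.
    have [y' [uy' _ /set1P yE]] := dependents_edge cy uc bu.
    by exists u, x; rewrite uc xj Jm // sym -yE uy' ux sym wx.
  have [u1 [x1 [u1c yu1 ux1 xw1 x1m]]] := far c1 c1y.
  have [u2 [x2 [u2c yu2 ux2 xw2 x2m]]] := far c2 c2y.
  have cm c u : c \in dependents e psi m [set y] -> psi u = c -> u != w.
    by case/dependentsP=> cm _ uc; apply: contraNneq cm => E; rewrite -uc E wm.
  have u12 : u1 != u2 by apply: contraNneq c12 => E; rewrite -u1c E u2c.
  have yx x : psi x != m -> y != x by apply: contraNneq => <-; rewrite ym.
  have [E|x12] := eqVneq x1 x2.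
    by case: (no_C4 sge girth7 yu1 ux1 (_ : e _ u2)); rewrite 1?sym // ?E ?yx.
  case: (no_C6 sge girth7 yu1 ux1 xw1 (_ : e _ x2) (_ : e _ u2)); rewrite 1?sym //.
  - exact: yx.
  - exact: cm u1c.
  - by rewrite eq_sym (cm c2).
  - by rewrite eq_sym yx.
  - by rewrite eq_sym.
apply/eqP; apply: contraT => /set0Pn[j jJ].
have /set0Pn[i iF] := F0 j jJ; have iJ := subsetP (FJ j jJ) i iF.
have ij : i != j.
  by move: iF; rewrite /F (negbTE (high j jJ)) => /setD1P[_ /dependentsP[]].
(* As [m] depends on both [X i] and [X j], [v] has common neighbors with [w] of both colors. *)
have class_m v : psi v = m -> v = w.
  move=> vm; have bv := allb v vm; apply/eqP; apply: contraNT ij => vw.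
  have [x [vx xj /XP[wx _]]] := dependents_edge (mF j jJ) vm bv.
  have [x' [vx' x'i /XP[wx' _]]] := dependents_edge (mF i iJ) vm bv.
  by apply/eqP; apply: (same x' x v); rewrite // 1?sym // eq_sym.
(* The b-vertex [u] sees [m] only at [w], so it lies in [X i], although [i] is far. *)
have [u ui bu] := has_b i.
have [|v uv /class_m vw] := bvertP _ _ _ _ bu m (in_setT m).
  by rewrite ui eq_sym Jm.
by have := Jnb iJ (_ : u \in X i); rewrite bu; apply; apply/XP; rewrite sym -vw.
Qed.

End MinimalClass.

Lemma hub_exists (psi0 : {ffun T -> C}) (c0 : C) :
  bcol e setT psi0 ->
  exists psi : {ffun T -> C}, exists w, bcol e setT psi /\
    forall c, c != psi w -> exists s, [/\ e w s, psi s = c & bvert e setT psi s].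
Proof.
move=> psi0_b.
have [[psi m] /= psi_b min_psi] :=
  @arg_minnP _ (psi0, c0) (fun p => bcol e setT p.1) class_weight psi0_b.
have {}min_psi psi' : bcol e setT psi' -> class_weight (psi, m) <= class_weight (psi', m).
  exact: (min_psi (psi', m)).
case/and3P: (psi_b) => _ _ /forall_inP/(_ m (in_setT m))/existsP[w /andP[/eqP wm bw]].
exists psi, w; split=> // c; rewrite wm => cm.
have /setP/(_ c) := far_colors_empty psi_b min_psi wm bw.
rewrite !inE cm /= => /negbT/forall_inPn[s].
by rewrite inE negbK => /andP[ws /eqP sc] bs; exists s.
Qed.

End Hub.

(** * Extending a partial coloring with one color fewer *)

Section Extension.

Variables (T : finType) (e : rel T) (C : finType).
Hypothesis sge : simple_graph e.
Hypothesis girth7 : girth_geq e 7.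
Variables (psi : {ffun T -> C}) (w : T) (d0 : C).
Hypothesis psi_b : bcol e setT psi.
Hypothesis d0w : d0 != psi w.
Hypothesis hub : forall c, c != psi w ->
  exists s, [/\ e w s, psi s = c & bvert e setT psi s].
Variables (chi : T -> nat) (n : nat).
Hypothesis chi_lt : forall v, chi v < n.
Hypothesis chi_proper : forall u v, e u v -> chi u != chi v.
Hypothesis leq_2n : 2 * n <= #|C|.-1.

Let sym : symmetric e := sge.1.

Let core := [set s | [&& e w s, psi s != d0 & bvert e setT psi s]].

Let P := [set v | (psi v != d0) && [exists s in core, (v == s) || e s v]].

Let coreP s : s \in core -> [/\ e w s, psi s != d0, bvert e setT psi s & s \in P].
Proof.
move=> sS; move: (sS); rewrite inE => /and3P[ws sd bs]; split=> //.
by rewrite inE sd; apply/exists_inP; exists s; rewrite ?eqxx.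
Qed.

Let PP v : v \in P ->
  psi v != d0 /\ exists s, [/\ e w s, s \in P & v = s \/ e s v].
Proof.
rewrite inE => /andP[vd /exists_inP[s /coreP[ws _ _ sP] vs]]; split=> //.
by exists s; split=> //; case/orP: vs => [/eqP|]; [left | right].
Qed.

Let nbr_P s v : s \in core -> e s v -> psi v != d0 -> v \in P.
Proof. by move=> sS sv vd; rewrite inE vd; apply/exists_inP; exists s; rewrite ?sv ?orbT. Qed.

Let w_P : w \in P.
Proof.
have n1 : 0 < n by apply: leq_ltn_trans (chi_lt w).
(* A color other than [d0] and [psi w] exists because [#|C|.-1] is at least [2 * n], hence at least
   2. *)
have /set0Pn[c] : [set~ d0] :\ psi w != set0.
  rewrite -card_gt0 -(ltn_add2l (psi w \in [set~ d0])) -cardsD1 cardsC1 addn0.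
  by apply: leq_trans leq_2n; apply: (@leq_ltn_trans 1); rewrite ?leq_b1 // (leq_mul2l 2 1).
case/setD1P=> cw; rewrite in_setC1 => cd; have [s [ws sc bs]] := hub cw.
have sS : s \in core by rewrite inE ws sc cd bs.
by apply: (nbr_P sS); rewrite 1?sym // eq_sym.
Qed.

(** Both [p] and [q] reach [w] within [P] by short paths. Together with [v], which is outside [P],
    these would contain a cycle of length at most 6. *)
Lemma unique_precolored_nbr v p q :
  v \notin P -> p \in P -> q \in P -> e v p -> e v q -> p = q.
Proof.
move=> vP pP qP vp vq; apply/eqP; apply: contraT => pq.
have vN x : x \in P -> v != x by apply: contraTneq => <-.
have [_ [s [ws sP ps]]] := PP pP; have [_ [t [wt tP qt]]] := PP qP.
have [pv qv] : e p v /\ e q v by rewrite !(sym _ v).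
have [sw tw] : e s w /\ e t w by rewrite !(sym _ w).
case: ps qt => [ps|sp] [qt|tq].
- by subst p q; case: (no_C4 sge girth7 vp sw wt qv); rewrite ?vN ?w_P.
- subst p; have [E|st] := eqVneq s t; first by subst t; case: (no_C3 sge girth7 vp tq qv).
  by case: (no_C5 sge girth7 vp sw wt tq qv).
- subst q; have [E|st] := eqVneq s t; first by subst t; rewrite sym in sp; case: (no_C3 sge girth7 vp sp qv).
  by rewrite sym in sp; case: (no_C5 sge girth7 vp sp sw wt qv).
rewrite sym in sp; have [E|st] := eqVneq s t.
  by subst t; case: (no_C4 sge girth7 vp sp tq qv); rewrite ?vN.
have [E|pw] := eqVneq p w.
  by subst p; case: (no_C4 sge girth7 vp wt tq qv); rewrite ?vN.
have [E|qw] := eqVneq q w.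
  by subst q; case: (no_C4 sge girth7 vp sp sw qv); rewrite ?vN.
by case: (no_C6 sge girth7 vp sp sw wt tq qv); rewrite // ?vN // eq_sym ?vN.
Qed.

Lemma hub_coloring : b_spectrum e #|C|.-1.
Proof.
have cardS : #|[set~ d0]| = #|C|.-1 by rewrite cardsC1.
(* The two colors available for color [i] of [chi] have positions [i] and [i + n] in the list of
   colors other than [d0]. *)
pose f i (b : bool) := nth d0 (enum [set~ d0]) (i + b * n).
have f_lt i (b : bool) : i < n -> i + b * n < size (enum [set~ d0]).
  move=> ilt; rewrite -cardE cardS; apply: leq_trans leq_2n.
  by rewrite mul2n -addnn -addSn leq_add //; case: b; rewrite ?mul1n.
have fS i b : i < n -> f i b != d0.
  by move=> ilt; have := mem_nth d0 (f_lt i b ilt); rewrite mem_enum !inE.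
have f_inj i i' (b b' : bool) : i < n -> i' < n -> f i b = f i' b' -> i = i' /\ b = b'.
  move=> ilt ilt' /eqP; rewrite nth_uniq ?enum_uniq ?f_lt //.
  by case: b b' => [] [] /eqP; rewrite ?mul1n ?mul0n ?addn0; lia.
pose blocked v := [exists u, [&& e v u, u \in P & psi u == f (chi v) false]].
pose phi := [ffun v => if v \in P then psi v else f (chi v) (blocked v)].
have phiP v : v \in P -> phi v = psi v by rewrite ffunE => ->.
have pr u v : e u v -> psi u != psi v.
  by case/and3P: psi_b => /proper_colP H _ _; apply: H.
(* If the first color is blocked, then by the only neighbor in [P], so the second color is free. *)
have mixed u v : e v u -> v \notin P -> u \in P -> f (chi v) (blocked v) != psi u.
  move=> vu vP uP; case: (boolP (blocked v)) => [/existsP[p /and3P[vp pP /eqP pE]]|].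
    rewrite (unique_precolored_nbr vP uP pP vu vp) pE.
    by apply/eqP => /f_inj-[] //; apply: chi_lt.
  move=> /existsPn/(_ u); rewrite vu uP /= eq_sym.
  exact.
rewrite -cardS; apply: (@bcol_b_spectrum _ _ _ _ phi); apply/and3P; split.
- apply/proper_colP => u v uv; rewrite !ffunE; case: ifPn => uP; case: ifPn => vP.
  + exact: pr.
  + by rewrite eq_sym mixed // sym.
  + exact: mixed.
  by apply: contra (chi_proper uv) => /eqP/f_inj-[] // ->.
- apply/forallP => v; rewrite !inE ffunE; case: ifP => [/PP[]//|_].
  exact: fS.
apply/forall_inP => c; rewrite !inE => cd.
(* Colors on [P] do not change, so a b-vertex whose required neighbors lie in [P] survives: [w] for
   its own color, a vertex of [core] for any other. *)
suff [v [vP vc bv]] : exists v, [/\ v \in P, psi v = c &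
    forall d, d != d0 -> d != c -> exists2 u, e v u & u \in P /\ psi u = d].
  apply/existsP; exists v; rewrite phiP // vc eqxx /=; apply/bvertP => d.
  rewrite !inE phiP // vc => dd0 dc; have [u vu [uP ud]] := bv d dd0 dc.
  by exists u; rewrite ?phiP.
have [cw|cw] := eqVneq c (psi w).
  exists w; split=> // d dd0; rewrite cw => dw; have [s [ws sd bs]] := hub dw.
  by exists s => //; split=> //; case: (@coreP s) => //; rewrite inE ws sd dd0 bs.
have [s [ws sc bs]] := hub cw.
have sS : s \in core by rewrite inE ws sc cd bs.
exists s; split=> //; first by case: (coreP sS).
move=> d dd0 dc; have [|u su ud] := bvertP _ _ _ _ bs d (in_setT d); first by rewrite sc.
by exists u => //; rewrite (nbr_P sS) ?ud.
Qed.

End Extension.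

(** * Descent by one color at a time *)

Lemma b_spectrum_pred (T : finType) (e : rel T) (sge : simple_graph e) (k : nat) :
  girth_geq e 7 -> 2 * chromatic_number sge <= k -> b_spectrum e k.+1 -> b_spectrum e k.
Proof.
move=> girth7; rewrite /chromatic_number; case: ex_minnP => n /asboolP[c [cn c_pr]] _ nk.
case/b_spectrum_bcol => psi0 psi0_b; apply: contrapT => nok.
have card_k : #|'I_k.+1|.-1 = k by rewrite card_ord.
rewrite -{1}card_k in nok.
have [psi [w [psi_b hub]]] := hub_exists sge girth7 nok ord0 psi0_b.
case: nok.
(* The colors of an optimal coloring are renumbered below [n]. *)
pose chi v := index (c v) (undup (codom c)).
have c_in v : c v \in undup (codom c) by rewrite mem_undup codom_f.
have chi_lt v : chi v < n by rewrite -cn index_mem.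
have chi_pr u v : e u v -> chi u != chi v.
  move/c_pr; apply: contra => /eqP E.
  by rewrite -(nth_index 0 (c_in u)) -(nth_index 0 (c_in v)) -/(chi u) E.
have k1 : 0 < k.
  by apply: leq_trans nk; rewrite muln_gt0 /=; apply: leq_ltn_trans (chi_lt w).
have [d0 d0w] : exists d0, d0 != psi w.
  have /set0Pn[d] : [set~ psi w] != set0 by rewrite -card_gt0 cardsC1 card_k.
  by rewrite !inE; exists d.
by apply: (hub_coloring sge girth7 psi_b d0w hub chi_lt chi_pr); rewrite card_k.
Qed.

Theorem theorem2 (T : finType) (e : rel T) (sge : simple_graph e) :
  girth_geq e 7 ->
  forall k : nat,
    2 * chromatic_number sge <= k <= b_chromatic_number sge -> b_spectrum e k.
Proof.
move=> girth7 k /andP[chi_k]; rewrite /b_chromatic_number.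
case: ex_maxnP => b /asboolP b_b _ /subnK bk; rewrite -{}bk in b_b.
elim: (b - k) b_b => [|i IH] b_i; first exact: b_i.
apply/IH/(b_spectrum_pred girth7 _ b_i).
by rewrite (leq_trans chi_k) // leq_addl.
Qed.
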